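(* For every fixed integer $d\ge3$ and every real $\gamma>0$, there is a constant $c_{d,\gamma}>0$, depending only on $d$ and $\gamma$, such that there are arbitrarily large integers $p$ for which, for every integer $s\ge1$, $$\mathrm{HD}_d^{(s)}(p,d+1)\ge c_{d,\gamma}\,s\,p^{2-\gamma}.$$ Thus, for every fixed $d\ge3$, along an unbounded sequence of values of $p$ one has $\mathrm{HD}_d^{(s)}(p,d+1)\ge s\,p^{2-o(1)}$ for every $s\ge1$.
   Context: A set in $\mathbb{R}^d$ is called $s$-convex if it is the union of at most $s$ convex sets. For positive integers $p\ge q$, a family $\mathcal F$ of (distinct) sets with at least $p$ members satisfies the $(p,q)$-property if among every $p$ members of $\mathcal F$ some $q$ have a nonempty common intersection. A transversal (piercing set) of $\mathcal F$ is a set of points meeting every member of $\mathcal F$, and $\tau(\mathcal F)$ is the minimum size of a transversal. For $p\ge q\ge d+1$, $\mathrm{HD}_d^{(s)}(p,q)$ denotes the least integer $N$ such that $\tau(\mathcal F)\le N$ for every finite family $\mathcal F$ of nonempty $s$-convex sets in $\mathbb{R}^d$ satisfying the $(p,q)$-property. The $o(1)$ term tends to $0$ as $p\to\infty$ along the sequence, independently of $s$. *)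

(* Defs.v *)
From HB Require Import structures.
From mathcomp Require Import all_boot all_order all_algebra.
From mathcomp Require Import all_classical all_reals all_analysis.

Set Implicit Arguments.
Unset Strict Implicit.
Unset Printing Implicit Defensive.

Import Order.TTheory GRing.Theory Num.Theory.

Local Open Scope classical_set_scope.
Local Open Scope card_scope.
Local Open Scope ring_scope.

(* The infimum is attained as soon as some natural number satisfies P
   (lemma [leastE]); it is +oo otherwise. *)
Definition least (R : realType) (P : set nat) : \bar R :=
  ereal_inf [set n%:R%:E | n in P].

Lemma leastE (R : realType) (P : set nat) (n : nat) :
  P n -> (forall m, P m -> (n <= m)%N) -> least R P = n%:R%:E.
Proof.
move=> Pn minn; apply/eqP; rewrite eq_le; apply/andP; split.
  by apply: ereal_inf_lbound; exists n.
by apply: le_ereal_inf_tmp => _ [m Pm <-]; rewrite lee_fin ler_nat; exact: minn.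
Qed.

Lemma least_leP (R : realType) (P : set nat) (N : nat) :
  (least R P <= N%:R%:E)%E <-> exists2 n, (n <= N)%N & P n.
Proof.
split=> [leN|[n nN Pn]]; last first.
  apply: (@le_trans _ _ (n%:R%:E)); last by rewrite lee_fin ler_nat.
  by apply: ereal_inf_lbound; exists n.
have [[n0 Pn0]|nP] := pselect (exists n, P n).
  have exP : exists n, `[< P n >] by exists n0; apply/asboolP.
  case: (ex_minnP exP) => n /asboolP Pn minn.
  exists n => //; move: leN; rewrite (@leastE _ _ n) ?lee_fin ?ler_nat//.
  by move=> m Pm; apply: minn; apply/asboolP.
have S0 : [set n%:R%:E | n in P] = set0 :> set (\bar R).
  by apply/seteqP; split => // x [n Pn _]; apply: nP; exists n.
by move: leN; rewrite /least S0 ereal_inf0 leye_eq.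
Qed.

Lemma least_geP (R : realType) (P : set nat) (x : \bar R) :
  (x <= least R P)%E <-> forall n, P n -> (x <= n%:R%:E)%E.
Proof.
split=> [xP n Pn|xP]; last by apply: le_ereal_inf_tmp => _ [n Pn <-]; exact: xP.
by apply: (le_trans xP); apply: ereal_inf_lbound; exists n.
Qed.

Section HadwigerDebrunner.
Variables (R : realType) (d : nat).
Implicit Types (A : set 'rV[R]_d) (F : set (set 'rV[R]_d)) (s p q n : nat).

Definition s_convex s A :=
  exists2 K : set (set 'rV[R]_d),
    (K #<= `I_s) /\ (forall C, K C -> convex_set C)
    & A = \bigcup_(C in K) C.

Definition pq_property p q F :=
  (`I_p #<= F) /\
  forall G, G `<=` F -> G #= `I_p ->
    exists H, [/\ H `<=` G, H #= `I_q & \bigcap_(A in H) A !=set0].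

Definition transversal F (T : set 'rV[R]_d) :=
  forall A, F A -> T `&` A !=set0.

Definition tau F : \bar R :=
  least R [set n | exists2 T, transversal F T & T #= `I_n].

Definition HD_bound s p q (N : nat) :=
  forall F, finite_set F -> (forall A, F A -> A !=set0 /\ s_convex s A) ->
    pq_property p q F -> (tau F <= N%:R%:E)%E.

Definition HD s p q : \bar R := least R (HD_bound s p q).

End HadwigerDebrunner.
Arguments HD R d s p q : clear implicits.

(* Main.v *)
Require Import Defs.
From mathcomp Require Import all_boot all_order all_algebra.
From mathcomp Require Import all_classical all_reals all_analysis.
From mathcomp Require Import lra ring zify.

(* Label hyperplanes by the points a of the box V = {1..m}^D: the equation of
   the a-th one in R^d is the linear form <a, .> of R^D restricted to a generic
   affine d-flat.  The forms are linear in a, and at most m^d points of V lie in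
   a d-dimensional subspace; so a point of R^d meets at most m^d of the
   hyperplanes, and even of their thin slabs.  Since |V + V| <= (2m)^D, a subset
   U of V with |U|^2 > (2m)^D m^2 contains independent points a, b, c such that
   a + b - c is in U too: adding d - 3 further points of U gives d + 1
   hyperplanes with a common point.  With m fixed and D growing, a set of about
   |V|^(1/2 + o(1)) hyperplanes thus contains d + 1 concurrent ones, while
   piercing all of them takes |V| / m^d points.

   The factor s comes from s disjoint copies of R^d.  The members are the pairs
   (j, a), j < s: in copy i, the member (j, a) is the slab of a if i = j, and a
   generic perturbation of the a-th hyperplane otherwise.  In the copy of a
   suitable one of d + 1 members whose labels are concurrent, the other d
   perturbed hyperplanes cross inside all the slabs, yet no d + 1 perturbed
   hyperplanes are concurrent, so that the number of members through a point is
   bounded independently of s. *)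

Import Order.TTheory GRing.Theory Num.Theory.
Import numFieldNormedType.Exports.

Set Implicit Arguments.
Unset Strict Implicit.
Unset Printing Implicit Defensive.

Local Open Scope ring_scope.

(** * Generic points *)

Section Genericity.
Variables (R : realFieldType) (E : lmodType R).
Implicit Types (f : E -> R) (P Q : E -> Prop).

(** Polynomiality is only asked along each line, so that counting roots of one-variable polynomials
    is enough. *)
Definition poly_on_lines f :=
  forall x v, exists p : {poly R}, forall t, f (x + t *: v) = p.[t].

(* Two nonempty generic conditions hold together somewhere on the line through
   their witnesses: this replaces Zariski-open sets. *)
Definition generic P :=
  exists f, [/\ poly_on_lines f, exists x, f x != 0 & forall x, f x != 0 -> P x].

Lemma poly_nonroot_near0 (p : {poly R}) (e : R) :
  p != 0 -> 0 < e -> exists t, [/\ 0 < t, t < e & p.[t] != 0].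
Proof.
move=> p0 e0.
(* These are [size p] distinct points between 0 and [e], more than [p] has roots. *)
pose s := [seq e / k.+2%:R | k <- iota 0 (size p)].
have us : uniq s.
  rewrite map_inj_uniq ?iota_uniq// => i j /(mulfI (lt0r_neq0 e0)) /invr_inj.
  by move=> /eqP; rewrite eqr_nat => /eqP[].
have /allPn[t /mapP[k _ ->] rt] : ~~ all (root p) s.
  apply/negP => /(max_poly_roots p0)/(_ us).
  by rewrite size_map size_iota ltnn.
exists (e / k.+2%:R); split => //; first by rewrite divr_gt0.
by rewrite ltr_pdivrMr// ltr_pMr// ltr1n.
Qed.

Lemma generic_sub P Q : (forall x, P x -> Q x) -> generic P -> generic Q.
Proof. by move=> PQ [f [pf f0 fP]]; exists f; split => // x /fP/PQ. Qed.

(** The direction [v] points from [x] to a witness. Along it the test function is a nonzero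
    polynomial in [t], so it has nonroots arbitrarily close to 0: given data reach general position
    by a small move. *)
Lemma generic_near P (x : E) : generic P ->
  exists v, forall e, 0 < e -> exists t, [/\ 0 < t, t < e & P (x + t *: v)].
Proof.
move=> [f [pf [x1 fx1] fP]]; exists (x1 - x) => e e0.
have [p pE] := pf x (x1 - x).
have p0 : p != 0.
  apply: contraNneq fx1 => p0.
  by have := pE 1; rewrite scale1r subrKC p0 horner0 => ->.
have [t [t0 te pt]] := poly_nonroot_near0 p0 e0.
by exists t; split => //; apply: fP; rewrite pE.
Qed.

Lemma generic_ex P : generic P -> exists x, P x.
Proof. by move=> [f [_ [x fx] fP]]; exists x; exact: fP. Qed.

Lemma generic_true : generic (fun=> True).
Proof.
exists (fun=> 1); split => // [x v|]; first by exists 1 => t; rewrite hornerC.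
by exists 0; rewrite oner_eq0.
Qed.

Lemma generic_and P Q : generic P -> generic Q -> generic (fun x => P x /\ Q x).
Proof.
move=> [f [pf [x fx] fP]] [g [pg [y gy] gQ]].
exists (fun z => f z * g z); split.
- move=> z v; have [p pE] := pf z v; have [q qE] := pg z v.
  by exists (p * q) => t; rewrite pE qE hornerM.
- have [p pE] := pf x (y - x); have [q qE] := pg x (y - x).
  have p0 : p != 0.
    apply: contraNneq fx => p0.
    by have := pE 0; rewrite scale0r addr0 p0 horner0 => ->.
  have q0 : q != 0.
    apply: contraNneq gy => q0.
    by have := qE 1; rewrite scale1r subrKC q0 horner0 => ->.
  have [|t [_ _]] := @poly_nonroot_near0 (p * q) 1 _ ltr01.
    by rewrite mulf_neq0.
  by rewrite hornerM => pq; exists (x + t *: (y - x)); rewrite pE qE.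
- by move=> z; rewrite mulf_eq0 => /norP[/fP ? /gQ].
Qed.

Lemma generic_forall (I : finType) (P : I -> E -> Prop) :
  (forall i, generic (P i)) -> generic (fun x => forall i, P i x).
Proof.
move=> gP.
suff gs (s : seq I) : generic (fun x => forall i, i \in s -> P i x).
  by apply: generic_sub (gs (enum I)) => x Px i; apply: Px; rewrite mem_enum.
elim: s => [|i s IHs]; first exact: generic_sub generic_true.
apply: generic_sub (generic_and (gP i) IHs) => x [Pi Ps] j.
by rewrite inE => /predU1P[->|/Ps].
Qed.

Lemma generic_imply (b : bool) P :
  (b -> generic P) -> generic (fun x => b -> P x).
Proof.
case: b => [/(_ isT)|_]; first exact: generic_sub.
exact: generic_sub generic_true.
Qed.

Lemma generic_lin f : (forall x v t, f (x + t *: v) = f x + t * f v) ->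
  (exists x, f x != 0) -> generic (fun x => f x != 0).
Proof.
move=> fl f0; exists f; split => // x v; exists ((f x)%:P + f v *: 'X) => t.
by rewrite fl !hornerE mulrC.
Qed.

Lemma generic_unitmx k (L : E -> 'M[R]_k) :
    (forall x v t, L (x + t *: v) = L x + t *: L v) ->
    (exists x, L x \in unitmx) ->
  generic (fun x => L x \in unitmx).
Proof.
move=> Ll [x Lx]; exists (fun z => \det (L z)); split.
- move=> z v.
  exists (\det (map_mx polyC (L z) + 'X *: map_mx polyC (L v))) => t.
  rewrite -horner_evalE -det_map_mx Ll; congr (\det _).
  by apply/matrixP => i j; rewrite !mxE /= horner_evalE !hornerE.
- by exists x; rewrite -unitfE -unitmxE.
- by move=> z; rewrite unitmxE unitfE.
Qed.

End Genericity.

(** * Points of a box *)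

Section Grid.
Variables (R : realFieldType) (m D : nat).
Hypothesis m_gt0 : (0 < m)%N.

Definition grid := {ffun 'I_D -> 'I_m}.

Definition gvec (z : grid) : 'rV[R]_D := \row_i (z i).+1%:R.

Definition gmat k (z : 'I_k -> grid) : 'M[R]_(k, D) := \matrix_i gvec (z i).

Lemma card_grid_submx k (B : 'M[R]_(k, D)) :
  (#|[set z : grid | (gvec z <= B)%MS]| <= m ^ k)%N.
Proof.
pose f := maxrankfun B^T.
pose g (z : grid) : {ffun 'I_(\rank B^T) -> 'I_m} := [ffun i => z (f i)].
have [P BP] : exists P, B^T = P *m rowsub f B^T.
  by apply/submxP; rewrite eq_maxrowsub.
(* A vector in the row space of [B] is determined by its [\rank B] coordinates
   in the range of [f]. *)
have det_by x : (x *m B)^T = P *m rowsub f (x *m B)^T.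
  by rewrite trmx_mul {1}BP -mulmxA mul_rowsub_mx.
have ginj : {in [set z : grid | (gvec z <= B)%MS] &, injective g}.
  move=> z1 z2; rewrite !inE => /submxP[x1 e1] /submxP[x2 e2] g12.
  have : gvec z1 = gvec z2.
    apply: trmx_inj; rewrite e1 e2 (det_by _ x1) (det_by _ x2) -e1 -e2; congr (P *m _).
    apply/matrixP => i j; rewrite !mxE.
    by have /ffunP/(_ i) := g12; rewrite !ffunE => ->.
  move=> /rowP v12; apply/ffunP => i; apply/val_inj/eqP.
  by have /eqP := v12 i; rewrite !mxE eqr_nat eqSS.
rewrite -(card_in_imset ginj) (leq_trans (max_card _))//.
by rewrite card_ffun !card_ord leq_pexp2l// mxrank_tr rank_leq_row.
Qed.

Lemma card_grid_span (X : seq 'rV[R]_D) :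
  (#|[set z : grid | gvec z \in <<X>>%VS]| <= m ^ size X)%N.
Proof.
apply: leq_trans (card_grid_submx (\matrix_(i < size X) tnth (in_tuple X) i)).
apply: subset_leq_card; apply/fintype.subsetP => z; rewrite !inE => zX.
rewrite (@coord_span _ _ _ (in_tuple X) _ zX).
apply: summx_sub => i _; apply: scalemx_sub.
by rewrite -tnth_nth -[X in (X <= _)%MS](rowK (tnth (in_tuple X))) row_sub.
Qed.

Lemma grid_notin_span (U : {set grid}) (X : seq 'rV[R]_D) :
  (m ^ size X < #|U|)%N -> exists2 z, z \in U & gvec z \notin <<X>>%VS.
Proof.
move=> XU; have /subsetPn[z zU] :
    ~~ (U \subset [set z : grid | gvec z \in <<X>>%VS]).
  apply: contraL XU => /subset_leq_card UX.
  by rewrite -leqNgt (leq_trans UX)// card_grid_span.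
by rewrite inE => zX; exists z.
Qed.

(** Greedy choice: each new point avoids the span of the earlier ones. The last choice has
    [e + size s - 1] vectors to avoid, whence the exponent. *)
Lemma free_extend (U : {set grid}) (s : seq grid) (e : nat) :
    free (map gvec s) -> {subset s <= U} ->
    (m ^ (e + size s).-1 < #|U|)%N ->
  exists y, [/\ size y = e, free (map gvec (y ++ s)) & {subset y ++ s <= U}].
Proof.
elim: e => [|e IHe] sf sU cU; first by exists [::].
have [|y [sy yf yU]] := IHe sf sU.
  by apply: leq_ltn_trans cU; rewrite leq_pexp2l// addSn/= leq_pred.
have [|z zU zy] := @grid_notin_span U (map gvec (y ++ s)).
  by rewrite size_map size_cat sy.
exists (z :: y); split; first by rewrite /= sy.
  by rewrite /= free_cons zy.
by move=> x; rewrite /= inE => /predU1P[->|/yU].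
Qed.

Lemma free_row_free k (f : 'I_k -> 'rV[R]_D) :
  free [tuple f i | i < k] -> row_free (\matrix_i f i).
Proof.
move=> /freeP ff; apply: inj_row_free => v v0; apply/rowP => i; rewrite mxE.
apply: (ff (fun i => v 0 i)); rewrite -[RHS]v0 mulmx_sum_row.
apply: eq_bigr => j _; rewrite rowK; congr (_ *: _).
by rewrite (nth_map j) ?size_enum_ord// nth_ord_enum.
Qed.

Lemma gmat_row_free k (s : k.-tuple grid) :
  free (map gvec s) -> row_free (gmat (tnth s)).
Proof.
move=> sf; apply: free_row_free.
suff -> : [tuple gvec (tnth s i) | i < k] = map gvec s :> seq _ by [].
by rewrite -[in RHS](map_tnth_enum s) -map_comp.
Qed.

Lemma grid_free_tuple k (U : {set grid}) : (m ^ k < #|U|)%N ->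
  exists z : 'I_k.+1 -> grid, (forall i, z i \in U) /\ row_free (gmat z).
Proof.
move=> kU.
have [|//||y [sy yf yU]] := @free_extend U [::] k.+1.
- by rewrite nil_free.
- by rewrite addn0.
rewrite cats0 in yf yU.
pose z i := tnth (Tuple (introT eqP sy)) i.
exists z; split => [i|]; first by apply: yU; exact: mem_tnth.
exact: gmat_row_free.
Qed.

(** Pigeonhole: the pairs of [U] have at most [(m + m) ^ D] sums, and a pair with a given sum is
    determined by its first term. More than [m ^ 2] first terms are wanted so that one of them
    avoids the span of two given vectors. *)
Lemma popular_sum (U : {set grid}) : ((m + m) ^ D * m ^ 2 < #|U| ^ 2)%N ->
  exists v : 'rV[R]_D,
    (m ^ 2 < #|[set a in U | [exists b in U, (gvec a + gvec b)%R == v]]|)%N.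
Proof.
move=> cU.
have sumP (a b : grid) i : (a i + b i < m + m)%N.
  by rewrite -addnS leq_add// ltnW.
pose sm (x : grid * grid) : {ffun 'I_D -> 'I_(m + m)} :=
  [ffun i => Ordinal (sumP x.1 x.2 i)].
pose fib c := [set x in finset.setX U U | sm x == c].
have [c cfib] : exists c, (m ^ 2 < #|fib c|)%N.
  apply/existsP; apply: contraLR cU; rewrite negb_exists -leqNgt => /forallP cf.
  rewrite -mulnn -cardsX -sum1_card (partition_big sm predT)//=.
  apply: (@leq_trans (\sum_(c : {ffun 'I_D -> 'I_(m + m)}) m ^ 2)).
    apply: leq_sum => c _; rewrite sum1dep_card.
    have := cf c; rewrite -leqNgt; apply: leq_trans.
    by apply: subset_leq_card; apply/fintype.subsetP => x; rewrite !inE.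
  by rewrite sum_nat_const card_ffun !card_ord.
(* Each of the two summands is shifted by 1 in [gvec]. *)
exists (\row_i (c i).+2%:R).
have finj : {in fib c &, injective fst}.
  move=> [a b] [a' b']; rewrite !inE/= => /andP[_ /eqP/ffunP e].
  move=> /andP[_ /eqP/ffunP e'] aa; congr pair => //; apply/ffunP => i.
  have := e i; rewrite -(e' i) !ffunE => /(congr1 val)/=; rewrite aa => /addnI.
  exact: val_inj.
apply: leq_trans cfib _; rewrite -(card_in_imset finj).
apply: subset_leq_card; apply/fintype.subsetP => _ /imsetP[[a b] ab ->].
move: ab; rewrite !inE/= => /andP[/andP[aU bU] /eqP/ffunP e]; rewrite aU/=.
apply/existsP; exists b; rewrite bU/=; apply/eqP/rowP => i; rewrite !mxE.
by rewrite -(e i) ffunE/= -natrD addnS addSn.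
Qed.

(** Two representations a + b = c + w of a popular sum v give w = a + b - c. Taking a outside the
    line of v, then c outside the span of a and v, makes a, b, c independent; the [e] vectors added
    to them get coefficient 0 in [u]. *)
Lemma grid_parallelogram (e : nat) (U : {set grid}) :
    (0 < D)%N -> ((m + m) ^ D * m ^ 2 < #|U| ^ 2)%N -> (m ^ e.+2 < #|U|)%N ->
  exists (z : 'I_e.+3 -> grid) (w : grid) (u : 'rV[R]_e.+3),
    [/\ forall i, z i \in U, w \in U, row_free (gmat z),
        gvec w = u *m gmat z & (forall i, `|u 0 i| <= 1) /\ forall i, w != z i].
Proof.
move=> D0 cU cU'; have [v] := popular_sum cU.
set Q := [set a in U | _] => cQ.
have [a aQ _] : exists2 a, a \in Q & gvec a \notin <<[::]>>%VS.
  by apply: grid_notin_span; apply: leq_ltn_trans cQ; rewrite leq_pexp2l.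
(* Coordinates of grid vectors start at 1, so a sum of two of them cannot vanish. *)
have v0 : v != 0.
  move: aQ; rewrite inE => /andP[_ /existsP[b /andP[_ /eqP <-]]].
  apply/eqP => /rowP/(_ (Ordinal D0)); rewrite !mxE -natrD => /eqP.
  by rewrite pnatr_eq0.
have {a aQ}[a aQ av] : exists2 a, a \in Q & gvec a \notin <<[:: v]>>%VS.
  by apply: grid_notin_span; apply: leq_ltn_trans cQ; rewrite leq_pexp2l.
have [c cQ' cav] : exists2 c, c \in Q & gvec c \notin <<[:: gvec a; v]>>%VS.
  exact: grid_notin_span.
have [aU [b bU abv]] : a \in U /\ exists2 b, b \in U & gvec a + gvec b = v.
  move: aQ; rewrite inE => /andP[-> /existsP[b /andP[bU /eqP e1]]].
  by split => //; exists b.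
have [cU1 [w wU cwv]] : c \in U /\ exists2 b, b \in U & gvec c + gvec b = v.
  move: cQ'; rewrite inE => /andP[-> /existsP[w /andP[wU /eqP e1]]].
  by split => //; exists w.
have spanE : <<[:: gvec c; gvec a; v]>>%VS = <<[:: gvec c; gvec a; gvec b]>>%VS.
  apply/eqP; rewrite eqEsubv; apply/andP; split; apply/span_subvP => x.
    rewrite !inE => /or3P[] /eqP->; rewrite -?abv ?memv_add//;
      try by apply: memv_span; rewrite !inE eqxx ?orbT.
    by apply: memvD; apply: memv_span; rewrite !inE eqxx ?orbT.
  rewrite !inE => /or3P[] /eqP->;
    try by apply: memv_span; rewrite !inE eqxx ?orbT.
  have -> : gvec b = v - gvec a by rewrite -abv addrC addKr.
  by apply: memvB; apply: memv_span; rewrite !inE eqxx ?orbT.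
have cab : free (map gvec [:: c; a; b]).
  rewrite /free /= -spanE -/(free [:: gvec c; gvec a; v]).
  have : free [:: gvec c; gvec a; v].
    by rewrite !free_cons cav av span_nil memv0 v0 nil_free.
  by rewrite /free.
have [||y [sy yf yU]] := @free_extend U [:: c; a; b] e cab.
- by move=> x; rewrite !inE => /or3P[] /eqP->.
- by rewrite /= addn3.
have ss : size (y ++ [:: c; a; b]) == e.+3 by rewrite size_cat sy addn3.
pose s := Tuple ss; pose z i := tnth s i.
have us : uniq s by apply: (@map_uniq _ _ gvec); exact: free_uniq.
pose co (x : grid) : R := (x == a)%:R + (x == b)%:R - (x == c)%:R.
pose u : 'rV[R]_e.+3 := \row_i co (z i).
have zf : row_free (gmat z) by exact: gmat_row_free.
move: us; rewrite /= cat_uniq => /and3P[uy /hasPn ycab /and4P[/=]].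
rewrite !inE negb_or => /andP[ca cb] ab _ _.
have cE : co c = -1.
  by rewrite /co eqxx (negbTE ca) (negbTE cb) !add0r.
have aE : co a = 1.
  by rewrite /co eqxx (negbTE ab) eq_sym (negbTE ca) subr0 addr0.
have bE : co b = 1.
  by rewrite /co eqxx (eq_sym b a) (negbTE ab) (eq_sym b c) (negbTE cb) subr0 add0r.
have wE : gvec w = u *m gmat z.
  rewrite mulmx_sum_row.
  transitivity (\sum_(x <- s) co x *: gvec x); last first.
    by rewrite big_tuple; apply: eq_bigr => i _; rewrite mxE rowK.
  rewrite /= big_cat/= big1_seq ?add0r.
    rewrite !big_cons big_nil cE aE bE scaleN1r !scale1r addr0 abv -cwv.
    by rewrite addKr.
  move=> x /andP[_ xy]; suff -> : co x = 0 by rewrite scale0r.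
  have xn x' : x' \in [:: c; a; b] -> x != x'.
    by move=> /ycab; apply: contraNneq => <-.
  by rewrite /co !(negbTE (xn _ _)) ?inE ?eqxx ?orbT// subr0 addr0.
have cs : c \in s by rewrite mem_cat !inE eqxx orbT.
exists z, w, u; split => //.
- by move=> i; apply: yU; exact: mem_tnth.
- split => [i|i].
    have [|] := boolP (z i \in [:: c; a; b]).
      by rewrite mxE !inE => /or3P[] /eqP->; rewrite ?cE ?aE ?bE ?normrN normr1.
    rewrite mxE !inE !negb_or /co => /and3P[/negbTE-> /negbTE-> /negbTE->].
    by rewrite subr0 addr0 normr0 ler01.
  (* Otherwise independence would make [u] a unit vector, whereas its coordinate at [c] is -1. *)
  apply: contraTneq isT => wi.
  have /(row_free_inj zf) /rowP : u *m gmat z = delta_mx 0 i *m gmat z.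
    by rewrite -wE wi -rowE rowK.
  have /tnthP[j jc] := cs.
  move=> /(_ j); rewrite !mxE /z -jc cE => /eqP.
  by rewrite lt_eqF// (lt_le_trans (ltrN10 _))// ler0n.
Qed.

End Grid.

(** * Slabs and perturbed hyperplanes *)

Section Perturbation.
Variable R : realFieldType.

Lemma uniform_radius (I : finType) (P : I -> R -> Prop) :
    (forall i e e', 0 < e' -> e' <= e -> P i e -> P i e') ->
    (forall i, exists2 e, 0 < e & P i e) ->
  exists2 e, 0 < e & forall i, P i e.
Proof.
move=> Pdown Pex.
suff [e e0 Pe] : exists2 e, 0 < e & forall i, i \in enum I -> P i e.
  by exists e => // i; apply: Pe; rewrite mem_enum.
elim: (enum I) => [|i s [e e0 Ps]]; first by exists 1.
have [e' e'0 Pi] := Pex i.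
have me0 : 0 < Num.min e e' by rewrite lt_min e0.
exists (Num.min e e') => // j; rewrite inE => /predU1P[->|/Ps].
  by apply: Pdown Pi => //; rewrite ge_min lexx orbT.
by apply: Pdown => //; rewrite ge_min lexx.
Qed.

Lemma bilinear_bound n (x y : 'I_n -> R) (e : R) :
  (forall i, `|y i| <= e) -> `|\sum_i x i * y i| <= e * \sum_i `|x i|.
Proof.
move=> ye; rewrite mulr_sumr; apply: le_trans (ler_norm_sum _ _ _) _.
by apply: ler_sum => i _; rewrite normrM mulrC ler_wpM2r.
Qed.

(** Here [A *m y = c + (A - B) *m y], so only a bound on [y] is missing. Applying [invmx A] bounds
    the sum [Y] of the absolute values of its entries by [K * (C + h + h * Y)], and the term in [Y]
    on the right is at most [Y / 2]. *)
Lemma solve_near n (A : 'M[R]_n) (c0 : 'cV[R]_n) (e : R) :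
    A \in unitmx -> 0 < e ->
  exists2 h, 0 < h & forall (B : 'M[R]_n) (c y : 'cV[R]_n),
    (forall i j, `|A i j - B i j| <= h) -> (forall i, `|c i 0 - c0 i 0| <= h) ->
    B *m y = c -> forall i, `|(A *m y) i 0 - c0 i 0| <= e.
Proof.
move=> Au e0.
pose K := \sum_i \sum_j `|invmx A i j|.
pose C := \sum_i `|c0 i 0|.
have K0 : 0 <= K by apply: sumr_ge0 => i _; exact: sumr_ge0.
have C0 : 0 <= C by exact: sumr_ge0.
pose Y0 := 2 * K * (C + 1).
have Y00 : 0 <= Y0 by rewrite /Y0; nra.
(* The three bounds serve, in order, to replace [C + h] by [C + 1], to absorb [K * h * Y], and to
   keep the final error [h + h * Y0] below [e]. *)
pose h := Num.min 1 (Num.min (2 * K + 1)^-1 (e / (Y0 + 1))).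
have h0 : 0 < h.
  rewrite /h !lt_min ltr01 invr_gt0 divr_gt0//; lra.
have h1 : h <= 1 by rewrite /h ge_min lexx.
have hK : h * K <= 1 / 2.
  have : h <= (2 * K + 1)^-1 by rewrite /h !ge_min lexx orbT.
  rewrite -[X in _ <= X]mul1r ler_pdivlMr; last by lra.
  by move=> ?; nra.
have he : h * (Y0 + 1) <= e.
  by rewrite -ler_pdivlMr ?ltr_wpDl// /h !ge_min lexx !orbT.
exists h => // B c y AB cc0 Byc.
pose Y := \sum_i `|y i 0|.
have Yge0 : 0 <= Y by exact: sumr_ge0.
have ABy i : `|((A - B) *m y) i 0| <= h * Y.
  rewrite mxE.
  under eq_bigr do rewrite mulrC.
  by apply: bilinear_bound => j; rewrite !mxE.
have AyE : A *m y = c + (A - B) *m y by rewrite mulmxBl Byc addrC subrK.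
have yE : y = invmx A *m (c + (A - B) *m y) by rewrite -AyE mulKmx.
have Y_le : Y <= Y0.
  suff : Y <= K * (C + h + h * Y).
    have : K * (h * Y) <= Y / 2 by rewrite mulrA (mulrC K); nra.
    rewrite /Y0 !mulrDr; nra.
  rewrite {1}/Y {1}yE /K mulr_suml; apply: ler_sum => i _.
  rewrite mxE mulrC; apply: bilinear_bound => j; rewrite mxE.
  apply: le_trans (ler_normD _ _) _; apply: lerD (ABy j).
  have -> : c j 0 = c0 j 0 + (c j 0 - c0 j 0) by rewrite addrC subrK.
  apply: le_trans (ler_normD _ _) _; apply: lerD (cc0 j).
  by rewrite /C (bigD1 j)//= lerDl sumr_ge0.
move=> i; rewrite AyE mxE addrAC; apply: le_trans he.
apply: le_trans (ler_normD _ _) _; rewrite mulrDr mulr1 [leRHS]addrC.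
apply: lerD; [exact: cc0 | apply: le_trans (ABy i) _].
by rewrite ler_pM2l.
Qed.

End Perturbation.

(** * Hyperplanes in general position *)

Section Configuration.
Variables (R : realFieldType) (d : nat).

Definition aff (c : 'rV[R]_d * R) (y : 'rV[R]_d) : R := (c.1 *m y^T) 0 0 + c.2.

Lemma affE c y : aff c y = \sum_j c.1 0 j * y 0 j + c.2.
Proof.
by rewrite /aff mxE; congr (_ + _); apply: eq_bigr => j _; rewrite mxE.
Qed.

Lemma set_inj_ord (T : finType) (A : {set T}) n : (n <= #|A|)%N ->
  exists k : 'I_n -> T, injective k /\ forall i, k i \in A.
Proof.
move=> nA; exists (fun i => enum_val (widen_ord nA i)); split => [i j|i].
  by move=> /enum_val_inj/(congr1 val)/= /val_inj.
exact: enum_valP.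
Qed.

(** The matrix [W] encodes the affine flat of the points W (1, y): its first column is a point, the
    others are directions. Hyperplanes with [d + 1] independent labels then have no common point,
    those with [d] independent labels have exactly one, and each hyperplane meets the axis [i0]. All
    three conditions are generic in [W], and there are finitely many of them. *)
Lemma generic_slice m D (i0 : 'I_d) : (0 < D)%N ->
  exists W : 'M[R]_(D, 1 + d),
    [/\ forall z : 'I_d.+1 -> grid m D, row_free (gmat R z) ->
          gmat R z *m W \in unitmx,
        forall z : 'I_d -> grid m D, row_free (gmat R z) ->
          gmat R z *m rsubmx W \in unitmx
      & forall a : grid m D, (gvec R a *m rsubmx W) 0 i0 != 0].
Proof.
move=> D0.
pose P1 (z : {ffun 'I_d.+1 -> grid m D}) (W : 'M[R]_(D, 1 + d)) :=
  row_free (gmat R z) -> (gmat R z *m W : 'M[R]_d.+1) \in unitmx.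
pose P2 (z : {ffun 'I_d -> grid m D}) (W : 'M[R]_(D, 1 + d)) :=
  row_free (gmat R z) -> gmat R z *m rsubmx W \in unitmx.
pose P3 (a : grid m D) (W : 'M[R]_(D, 1 + d)) :=
  (gvec R a *m rsubmx W) 0 i0 != 0.
have gP1 z : generic (P1 z).
  apply: generic_imply => zf; apply: generic_unitmx => [x v t|].
    by rewrite mulmxDr -scalemxAr.
  by have /row_freeP[W zW] := zf; exists W; rewrite zW unitmx1.
have gP2 z : generic (P2 z).
  apply: generic_imply => zf; apply: generic_unitmx => [x v t|].
    by rewrite linearD linearZ/= mulmxDr -scalemxAr.
  have /row_freeP[W zW] := zf.
  by exists (row_mx 0 W); rewrite row_mxKr zW unitmx1.
have gP3 a : generic (P3 a).
  apply: generic_lin => [x v t|].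
    by rewrite linearD linearZ/= mulmxDr -scalemxAr !mxE.
  exists (const_mx 1); rewrite mxE gt_eqF//.
  rewrite (bigD1 (Ordinal D0))//= ltr_wpDr//.
    by apply: sumr_ge0 => j _; rewrite !mxE mulr1 ler0n.
  by rewrite !mxE mulr1 ltr0n.
have [W [H1 [H2 H3]]] := generic_ex (generic_and (generic_forall gP1)
  (generic_and (generic_forall gP2) (generic_forall gP3))).
exists W; split => // z zf.
- have gE : gmat R (finfun z) = gmat R z.
    by apply/matrixP => i j; rewrite !mxE ffunE.
  by have := H1 (finfun z); rewrite /P1 gE; exact.
- have gE : gmat R (finfun z) = gmat R z.
    by apply/matrixP => i j; rewrite !mxE ffunE.
  by have := H2 (finfun z); rewrite /P2 gE; exact.
Qed.

(** Among more than [m ^ d] labels, [d + 1] are independent. If their forms were all tiny at [y],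
    then inverting the system would make the vector (1, y) have a first coordinate smaller than 1;
    [K] bounds the first rows of all these inverses. *)
Lemma slab_degree m D (W : 'M[R]_(D, 1 + d)) : (0 < m)%N ->
    (forall z : 'I_d.+1 -> grid m D, row_free (gmat R z) ->
       gmat R z *m W \in unitmx) ->
  exists2 e, 0 < e & forall y : 'rV[R]_d,
    (#|[set a : grid m D |
        (`|(gvec R a *m W *m col_mx 1%:M y^T) 0 0| <= e)%R]| <= m ^ d)%N.
Proof.
move=> m0 HW.
pose iM (z : {ffun 'I_d.+1 -> grid m D}) := invmx (gmat R z *m W : 'M[R]_d.+1).
pose K := \sum_z \sum_j `|iM z 0 j|.
have K0 : 0 <= K by apply: sumr_ge0 => z _; exact: sumr_ge0.
have K1 : 0 < K + 1 by lra.
exists (K + 1)^-1 => [|y]; first by rewrite invr_gt0.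
rewrite leqNgt; apply/negP => /(grid_free_tuple R m0)[z' [zA zf]].
pose z := finfun z'.
have gE : gmat R z = gmat R z' by apply/matrixP => i j; rewrite !mxE ffunE.
have Mu : (gmat R z *m W : 'M[R]_d.+1) \in unitmx by rewrite gE; exact: HW.
pose v : 'cV[R]_d.+1 :=
  (gmat R z *m W : 'M[R]_d.+1) *m (col_mx 1%:M y^T : 'cV[R]_(1 + d)).
have v_le i : `|v i 0| <= (K + 1)^-1.
  have := zA i; rewrite inE; congr (`|_| <= _).
  rewrite /v gE -mulmxA -[in RHS]mulmxA [RHS]mxE [LHS]mxE.
  by apply: eq_bigr => j _; congr (_ * _); rewrite !mxE.
have : (col_mx 1%:M y^T : 'cV[R]_(1 + d)) 0 0 = 1.
  have -> : 0 = lshift d 0 :> 'I_(1 + d) by exact: val_inj.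
  by rewrite col_mxEu mxE.
rewrite -[col_mx _ _](mulKmx Mu) -/v -/(iM z) mxE => /eqP; apply/negP.
rewrite lt_eqF//; apply: le_lt_trans (ler_norm _) _.
apply: le_lt_trans (bilinear_bound (e := (K + 1)^-1) _ _) _ => //.
rewrite mulrC ltr_pdivrMr// mul1r.
apply: (@le_lt_trans _ _ K); last by lra.
by rewrite /K (bigD1 z)//= lerDl sumr_ge0// => ? _; exact: sumr_ge0.
Qed.


Lemma generic_directions (K : finType) (rho0 : K -> 'rV[R]_d) (h : R) : 0 < h ->
  exists rho : K -> 'rV[R]_d,
    (forall x j, `|rho0 x 0 j - rho x 0 j| <= h) /\
    forall k : 'I_d -> K, injective k -> (\matrix_i rho (k i)) \in unitmx.
Proof.
move=> h0.
pose P (k : {ffun 'I_d -> K}) (rho : {ffun K -> 'rV[R]_d}) :=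
  injectiveb k -> (\matrix_i rho (k i)) \in unitmx.
have gP k : generic (P k).
  apply: generic_imply => /injectiveP kinj.
  apply: generic_unitmx => [x v t|].
    by apply/matrixP => i j; rewrite !mxE !ffunE !mxE.
  exists [ffun x => \sum_i (k i == x)%:R *: delta_mx 0 i].
  suff -> : \matrix_i ([ffun x => \sum_i (k i == x)%:R *: delta_mx 0 i] (k i))
            = 1%:M :> 'M[R]_d.
    exact: unitmx1.
  apply/row_matrixP => i; rewrite rowK ffunE row1 (bigD1 i)//= eqxx scale1r.
  by rewrite big1 ?addr0// => j ji; rewrite (inj_eq kinj) (negbTE ji) scale0r.
have [v Hv] := generic_near (finfun rho0) (generic_forall gP).
pose C := \sum_x \sum_j `|v x 0 j|.
have C0 : 0 <= C by apply: sumr_ge0 => x _; exact: sumr_ge0.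
have [|t [t0 th Pt]] := Hv (h / (C + 1)); first by rewrite divr_gt0// ltr_wpDl.
exists (finfun rho0 + t *: v); split => [x j|k kinj].
  rewrite !ffunE !mxE opprD addrA subrr sub0r normrN normrM gtr0_norm//.
  have vC : `|v x 0 j| <= C + 1.
    rewrite /C (bigD1 x)//= (bigD1 j)//= -!addrA lerDl.
    by rewrite !addr_ge0 ?sumr_ge0// => ? _; exact: sumr_ge0.
  apply: le_trans (ler_wpM2l (ltW t0) vC) _.
  by rewrite -ler_pdivlMr ?ltW// ltr_wpDl.
have := Pt (finfun k); rewrite /P.
have kE : finfun k =1 k by move=> i; rewrite ffunE.
have -> : \matrix_i (finfun rho0 + t *: v) (finfun k i) =
          \matrix_i (finfun rho0 + t *: v) (k i).
  by apply/row_matrixP => i; rewrite !rowK kE.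
by apply; apply/injectiveP => i j; rewrite !kE => /kinj.
Qed.

(** Any [d + 1] vectors of R^d satisfy a linear relation. A common point would force the same
    relation on the offsets, and generic offsets violate it. *)
Lemma generic_offsets (K : finType) (rho : K -> 'rV[R]_d) (r0 : K -> R) (h : R) :
  0 < h ->
  exists r : K -> R, (forall x, `|r x - r0 x| <= h) /\
    forall y : 'rV[R]_d, (#|[set x | ((rho x *m y^T) 0 0)%R == r x]| <= d)%N.
Proof.
move=> h0.
pose P (k : {ffun 'I_d.+1 -> K}) (r : {ffun K -> R^o}) := injectiveb k ->
  ~ exists y : 'rV[R]_d, forall i, (rho (k i) *m y^T) 0 0 = r (k i).
have gP k : generic (P k).
  apply: generic_imply => /injectiveP kinj.
  pose B := \matrix_i rho (k i).
  have : kermx B != 0.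
    by rewrite kermx_eq0 /row_free neq_ltn ltnS rank_leq_col.
  move=> /matrix0Pn[i1 [j1 cj1]]; pose c := row i1 (kermx B).
  have cB : c *m B = 0 by rewrite -row_mul mulmx_ker row0.
  apply: (@generic_sub _ _ (fun r : {ffun K -> R^o} => \sum_i c 0 i * r (k i) != 0)).
    move=> r /eqP cr [y yr]; apply: cr.
    transitivity ((c *m B *m y^T) 0 0); last by rewrite cB mul0mx mxE.
    rewrite -mulmxA mxE; apply: eq_bigr => i _; rewrite -yr; congr (_ * _).
    by rewrite !mxE; apply: eq_bigr => j _; rewrite !mxE.
  apply: generic_lin => [x v t|].
    rewrite mulr_sumr -big_split; apply: eq_bigr => i _ /=.
    by rewrite !ffunE mulrDr mulrCA.
  exists [ffun x => (x == k j1)%:R].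
  rewrite (bigD1 j1)//= ffunE eqxx mulr1 big1 ?addr0 => [|j jj]; first by rewrite mxE.
  by rewrite ffunE (inj_eq kinj) (negbTE jj) mulr0.
have [v Hv] := generic_near (finfun r0 : {ffun K -> R^o}) (generic_forall gP).
pose C := \sum_x `|v x|.
have C0 : 0 <= C by exact: sumr_ge0.
have [|t [t0 th Pt]] := Hv (h / (C + 1)); first by rewrite divr_gt0// ltr_wpDl.
pose r : {ffun K -> R^o} := (finfun r0 : {ffun K -> R^o}) + t *: v.
exists r; split => [x|y].
  rewrite !ffunE addrC addKr normrM gtr0_norm//.
  have vC : `|v x| <= C + 1.
    by rewrite /C (bigD1 x)//= -!addrA lerDl addr_ge0 ?sumr_ge0.
  apply: le_trans (ler_wpM2l (ltW t0) vC) _.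
  by rewrite -ler_pdivlMr ?ltW// ltr_wpDl.
rewrite leqNgt; apply/negP => /set_inj_ord[k [kinj kA]].
have kE : finfun k =1 k by move=> i; rewrite ffunE.
have [|] := Pt (finfun k).
  by apply/injectiveP => i j; rewrite !kE => /kinj.
by exists y => i; rewrite kE; have := kA i; rewrite inE => /eqP.
Qed.

End Configuration.

(** * Perturbed hyperplanes crossing inside slabs *)

Section Crossing.
Variables (R : realFieldType) (e m D s p0 : nat).
Local Notation d := e.+3.
Hypotheses (m_gt0 : (0 < m)%N) (D_gt0 : (0 < D)%N).
Hypotheses (p0_sum : ((m + m) ^ D * m ^ 2 < p0 ^ 2)%N) (p0_span : (m ^ e.+2 < p0)%N).
Local Notation V := (grid m D).
Local Notation K := ('I_s * V)%type.

(** Tolerances are fixed in order: the slab width [delta], then [h1] for crossings with independent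
    labels, then the normals [rho], then [h2] for crossings with one repeated label, which depends
    on [rho], and finally the offsets [r]. *)
Lemma near_planes : exists (c : V -> 'rV[R]_d * R)
    (g : K -> 'rV[R]_d * R) (delta : R),
  [/\ forall y, (#|[set a | (`|aff (c a) y| <= delta)%R]| <= m ^ d)%N,
      forall y, (#|[set x | (aff (g x) y == 0)%R]| <= d)%N,
      forall a, exists y, `|aff (c a) y| <= delta
    & (forall (k : 'I_d -> K) a, injective k -> (forall i, (k i).2 = a) ->
        exists y, (forall i, aff (g (k i)) y = 0) /\ `|aff (c a) y| <= delta) /\
      (forall (k : 'I_d -> K) (w : V) (u : 'rV[R]_d),
        row_free (gmat R (snd \o k)) ->
        gvec R w = u *m gmat R (snd \o k) -> (forall i, `|u 0 i| <= 1) ->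
        exists y, [/\ forall i, aff (g (k i)) y = 0,
          forall i, `|aff (c (k i).2) y| <= delta & `|aff (c w) y| <= delta])].
Proof.
have [W [HW HL Hi]] := generic_slice R m (ord0 : 'I_d) D_gt0.
have [delta delta0 Hdelta] := slab_degree m_gt0 HW.
pose L := rsubmx W; pose w0 := lsubmx W.
pose c (a : V) := (gvec R a *m L, (gvec R a *m w0) 0 0).
have cE a y : aff (c a) y = (gvec R a *m W *m col_mx 1%:M y^T) 0 0.
  rewrite -[W]hsubmxK mul_mx_row mul_row_col mulmx1 mxE addrC /aff /c/=.
  by [].
(* The perturbed planes of the same label [a] all pass near [y0 a]; their
   directions are fixed first, so that they cross arbitrarily close to it. *)
pose y0 (a : V) : 'rV[R]_d := - ((c a).2 / (c a).1 0 0) *: delta_mx 0 0.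
have cy0 a : aff (c a) (y0 a) = 0.
  rewrite affE (bigD1 ord0)//= big1 => [|j j0]; last first.
    by rewrite !mxE (negbTE j0) !mulr0.
  have y00 : y0 a 0 0 = - ((c a).2 / (c a).1 0 0) by rewrite !mxE !eqxx mulr1.
  by rewrite addr0 y00 mulrN mulrC divfK ?addNr// Hi.
(* The form of [w] will be a combination of [d] forms with coefficients at most 1 in absolute
   value. *)
pose eps := delta / d%:R.
have eps0 : 0 < eps by rewrite divr_gt0// ltr0n.
have [h1 h10 Hh1] : exists2 h, 0 < h & forall z : {ffun 'I_d -> V},
    row_free (gmat R z) -> forall (B : 'M[R]_d) (b y : 'cV[R]_d),
    (forall i j, `|(gmat R z *m L) i j - B i j| <= h) ->
    (forall i, `|b i 0 - (- (gmat R z *m w0)) i 0| <= h) ->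
    B *m y = b ->
    forall i, `|(gmat R z *m L *m y) i 0 - (- (gmat R z *m w0)) i 0| <= eps.
  apply: uniform_radius => [z h h' h'0 h'h Hz zf B b y AB bc|z].
    by apply: Hz => // *; apply: le_trans h'h; [exact: AB|exact: bc].
  have [zf|_] := boolP (row_free (gmat R z)); last by exists 1.
  by have [h h0 Hh] := solve_near (- (gmat R z *m w0)) (HL z zf) eps0; exists h.
pose Yb := \sum_a \sum_j `|y0 a 0 j|.
have Yb0 : 0 <= Yb by apply: sumr_ge0 => a _; exact: sumr_ge0.
(* The change of normal then alters the value at [y0 a] by at most [h1 / 2]; the other half of [h1]
   is left to the offset. *)
have [|rho [rhoc rhou]] :=
    @generic_directions R d K (fun x => (c x.2).1) (h1 / 2 / (Yb + 1)).
  by rewrite !divr_gt0// ltr_wpDl.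
pose B (k : 'I_d -> K) := \matrix_i rho (k i).
(* When all labels are [a], the crossing point differs from [y0 a] by [invmx (B k) *m f], with [f]
   the residual of the offsets at [y0 a]. *)
have [h2 h20 Hh2] : exists2 h, 0 < h & forall x : V * {ffun 'I_d -> K},
    forall f : 'cV[R]_d, (forall i, `|f i 0| <= h) ->
    `|((c x.1).1 *m invmx (B x.2) *m f) 0 0| <= delta.
  apply: uniform_radius => [x h h' h'0 h'h Hx f fh|x].
    by apply: Hx => i; exact: le_trans h'h.
  pose S := \sum_j `|((c x.1).1 *m invmx (B x.2)) 0 j|.
  have S1 : 0 < S + 1 by rewrite ltr_wpDl ?sumr_ge0.
  exists (delta / (S + 1)) => [|f fh]; first by rewrite divr_gt0.
  rewrite mxE; apply: le_trans (bilinear_bound _ fh) _.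
  rewrite mulrAC ler_pdivrMr// ler_pM2l// lerDl ler01//.
have [|r [rc rd]] := @generic_offsets R d K rho
    (fun x => (rho x *m (y0 x.2)^T) 0 0) (Num.min (h1 / 2) h2).
  by rewrite lt_min h20 divr_gt0.
pose g x := (rho x, - r x).
have gE x y : (aff (g x) y == 0) = ((rho x *m y^T) 0 0 == r x).
  by rewrite /aff/= subr_eq0.
have sol (k : 'I_d -> K) : injective k ->
    forall i, aff (g (k i)) (invmx (B k) *m \col_i r (k i))^T = 0.
  move=> kinj i; apply/eqP; rewrite gE trmxK; apply/eqP.
  have := congr1 (fun M : 'cV[R]_d => M i 0) (mulKVmx (rhou k kinj) (\col_i r (k i))).
  rewrite [RHS]mxE => <-; rewrite [LHS]mxE [RHS]mxE; apply: eq_bigr => j _.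
  by rewrite [in RHS]mxE.
exists c, g, delta; split => [y|y|a|].
- by under eq_finset do rewrite cE.
- by under eq_finset do rewrite gE.
- by exists (y0 a); rewrite cy0 normr0 ltW.
split => [k a kinj ka|k w u kf wu u1].
  have kE : finfun k =1 k by move=> i; rewrite ffunE.
  exists (invmx (B k) *m \col_i r (k i))^T; split; first exact: sol.
  pose f := \col_i r (k i) - B k *m (y0 a)^T.
  have BE : B (finfun k) = B k by apply/row_matrixP => i; rewrite !rowK kE.
  have := Hh2 (a, finfun k) f; rewrite /= BE.
  suff -> : aff (c a) (invmx (B k) *m \col_i r (k i))^T =
       ((c a).1 *m invmx (B k) *m f) 0 0.
    apply => i; have := rc (k i); rewrite ka le_min => /andP[_].
    congr (`|_| <= _); rewrite /f !mxE; congr (_ - _).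
    by apply: eq_bigr => j _; rewrite !mxE.
  rewrite /f mulmxBr -!mulmxA mulKmx; last exact: rhou.
  rewrite -[LHS]subr0 -(cy0 a) /aff trmxK opprD addrACA subrr addr0.
  by rewrite [RHS]mxE [X in _ = _ + X]mxE /c /= !mulmxA.
have kinj : injective k.
  move=> i j kij; have : row i (gmat R (snd \o k)) = row j (gmat R (snd \o k)).
    by rewrite !rowK /= kij.
  rewrite !rowE => /(row_free_inj kf)/rowP/(_ i); rewrite !mxE !eqxx/=.
  by case: eqP => //= _ /eqP; rewrite oner_eq0.
pose y := (invmx (B k) *m \col_i r (k i))^T.
pose z := [ffun i => (k i).2].
have zE : gmat R z = gmat R (snd \o k).
  by apply/row_matrixP => i; rewrite !rowK ffunE.
have rowz i x (M : 'M[R]_(D, x)) j : (gmat R z *m M) i j = (gvec R (k i).2 *m M) 0 j.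
  have := congr1 (fun N : 'rV[R]_x => N 0 j) (row_mul i (gmat R z) M).
  by rewrite zE rowK mxE.
have yeps i : `|aff (c (k i).2) y| <= eps.
  have := Hh1 z; rewrite zE -zE => /(_ _ (B k) (\col_i r (k i)) y^T).
  rewrite {1}zE => /(_ kf).
  have -> : aff (c (k i).2) y = (gmat R z *m L *m y^T) i 0 - (- (gmat R z *m w0)) i 0.
    by rewrite [X in _ = _ - X]mxE opprK -mulmxA !rowz mulmxA.
  apply => [i' j'|i'|].
  - rewrite rowz [B k i' j']mxE; apply: le_trans (rhoc _ _) _.
    rewrite ler_pdivrMr; last by rewrite ltr_wpDl.
    nra.
  - rewrite [X in X - _]mxE [X in _ - X]mxE opprK rowz.
    have := rc (k i'); rewrite le_min => /andP[rc1 _].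
    set a := (k i').2 in rc1 *.
    (* Since the form of [a] vanishes at [y0 a], its constant term is traded for a value there; this
       separates the error in the offset from the error in the normal. *)
    have -> : r (k i') + (gvec R a *m w0) 0 0 =
       (r (k i') - (rho (k i') *m (y0 a)^T) 0 0) -
       \sum_j y0 a 0 j * ((c a).1 0 j - rho (k i') 0 j).
      have := cy0 a; rewrite affE /= => /eqP; rewrite addrC addr_eq0 => /eqP ->.
      rewrite mxE -addrA; congr (_ + _); rewrite -opprD; congr (- _).
      rewrite -big_split/=; apply: eq_bigr => j _.
      by rewrite [(y0 a)^T _ _]mxE; ring.
    apply: le_trans (ler_normB _ _) _.
    rewrite [leRHS](splitr h1); apply: lerD => //.
    apply: le_trans (bilinear_bound (e := h1 / 2 / (Yb + 1)) _ _) _ => //.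
      by move=> j; exact: rhoc.
    rewrite mulrAC ler_pdivrMr ?ltr_wpDl// ler_pM2l ?divr_gt0//.
    apply: (@le_trans _ _ Yb); last by rewrite lerDl.
    by rewrite /Yb (bigD1 a)//= lerDl sumr_ge0// => ? _; exact: sumr_ge0.
  - by rewrite trmxK mulKVmx//; exact: rhou.
exists y; split => [|i|]; first exact: sol.
  apply: le_trans (yeps i) _; rewrite ler_pdivrMr ?ltr0n//.
  by apply: ler_peMr; [exact: ltW | rewrite ler1n].
(* Normal and constant term are both linear in the label. *)
have -> : aff (c w) y = \sum_i u 0 i * aff (c (k i).2) y.
  rewrite {1}/aff /c /= wu -!mulmxA mxE [X in _ + X]mxE -big_split/=.
  apply: eq_bigr => i _; rewrite -mulrDr; congr (_ * _).
  by rewrite -zE !rowz /aff /c /= mulmxA.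
apply: le_trans (bilinear_bound (e := eps) _ _) _ => //.
rewrite /eps mulrAC ler_pdivrMr ?ltr0n// ler_pM2l//.
by apply: le_trans (ler_sum _ (fun i _ => u1 i)) _; rewrite sumr_const card_ord.
Qed.

(** Either some label occurs more than [d] times in [S], and [d + 1] of its members cross near one
    point of its hyperplane; or more than [p0] labels occur, and a parallelogram among them gives
    [d] independent labels and the dependent one [w], whose member is [x0]. *)
Lemma crossing_planes : exists (c : V -> 'rV[R]_d * R)
    (g : K -> 'rV[R]_d * R) (delta : R),
  [/\ forall y, (#|[set a | (`|aff (c a) y| <= delta)%R]| <= m ^ d)%N,
      forall y, (#|[set x | (aff (g x) y == 0)%R]| <= d)%N,
      forall a, exists y, `|aff (c a) y| <= delta
    & forall S : {set K}, (d * p0 < #|S|)%N ->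
        exists (H : {set K}) (x0 : K) (y : 'rV[R]_d),
          [/\ H \subset S, #|H| = d.+1, x0 \in H,
              forall x, x \in H -> `|aff (c x.2) y| <= delta
            & forall x, x \in H -> x != x0 -> aff (g x) y = 0]].
Proof.
have [c [g [delta [dc dg c_ex [same indep]]]]] := near_planes.
exists c, g, delta; split => // S cS.
have [/existsP[a Sa]|small] := boolP [exists a, (d < #|[set x in S | x.2 == a]|)%N].
  have [k [kinj kS]] := set_inj_ord Sa.
  have kP i : k i \in S /\ (k i).2 = a.
    by have := kS i; rewrite inE => /andP[-> /eqP].
  have [||y [gy cy]] := same (k \o lift ord0) a.
  - by move=> i j /kinj/lift_inj.
  - by move=> i; exact: (kP _).2.
  exists [set k i | i : 'I_d.+1], (k ord0), y; split.
  - by apply/fintype.subsetP => _ /imsetP[i _ ->]; exact: (kP i).1.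
  - by rewrite card_imset// card_ord.
  - exact: imset_f.
  - by move=> _ /imsetP[i _ ->]; rewrite (kP i).2.
  - move=> _ /imsetP[i _ ->]; case: (unliftP ord0 i) => [j ->|->].
      by move=> _; exact: gy.
    by rewrite eqxx.
pose U := [set x.2 | x in S].
have cU : (p0 < #|U|)%N.
  rewrite -(@ltn_pmul2l d)//; apply: leq_trans cS _.
  rewrite -sum1_card (partition_big snd (mem U))/=; last first.
    by move=> x xS; apply: imset_f.
  rewrite mulnC -sum_nat_const; apply: leq_sum => a _; rewrite sum1dep_card.
  by move: small; rewrite negb_exists => /forallP/(_ a); rewrite -leqNgt.
have [x1 x1S] : exists x, x \in S.
  by apply/finset.set0Pn; rewrite -card_gt0 (leq_ltn_trans _ cS).
(* One member of [S] above each label of [U]; the default [x1] is only taken outside [U]. *)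
pose sec a := odflt x1 [pick x in S | x.2 == a].
have secP a : a \in U -> sec a \in S /\ (sec a).2 = a.
  rewrite /sec => /imsetP[x xS ->]; case: pickP => [x' /andP[? /eqP]//|].
  by move=> /(_ x); rewrite xS eqxx.
have [|//||z [w [u [zU wU zf wu [u1 wz]]]]] := @grid_parallelogram R m D m_gt0 e U.
- by [].
- by apply: ltn_trans p0_sum _; rewrite ltn_sqr.
- exact: ltn_trans p0_span cU.
have zE : gmat R (snd \o (sec \o z)) = gmat R z.
  by apply/row_matrixP => i; rewrite !rowK /= (secP _ (zU i)).2.
have [|||y [gy cy cwy]] := indep (sec \o z) w u.
- by rewrite zE.
- by rewrite zE.
- exact: u1.
have zinj : injective z.
  move=> i j zij; have : row i (gmat R z) = row j (gmat R z) by rewrite !rowK zij.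
  rewrite !rowE => /(row_free_inj zf)/rowP/(_ i); rewrite !mxE !eqxx/=.
  by case: eqP => //= _ /eqP; rewrite oner_eq0.
have secinj : {in U &, injective sec}.
  by move=> a b aU bU ab; rewrite -(secP a aU).2 -(secP b bU).2 ab.
pose Z := w |: [set z i | i : 'I_d].
have ZU : {subset Z <= U}.
  by move=> x /setU1P[->//|/imsetP[i _ ->]]; exact: zU.
exists [set sec x | x in Z], (sec w), y; split.
- by apply/fintype.subsetP => _ /imsetP[x /ZU/secP[? _] ->].
- rewrite card_in_imset; last by move=> a b /ZU aU /ZU; exact: secinj.
  rewrite cardsU1 card_imset// card_ord.
  suff -> : w \notin [set z i | i : 'I_d] by [].
  by apply/imsetP => -[i _ wi]; have := wz i; rewrite wi eqxx.
- by apply: imset_f; rewrite finset.setU11.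
- move=> _ /imsetP[x /setU1P[->|/imsetP[i _ ->]] ->]; first by rewrite (secP _ wU).2.
  exact: cy.
- move=> _ /imsetP[x /setU1P[->|/imsetP[i _ ->]] ->]; first by rewrite eqxx.
  by move=> _; exact: gy.
Qed.

End Crossing.

(** * Families of s-convex sets *)

Local Open Scope classical_set_scope.

Lemma card_eq_finset (T : finType) (S : {set T}) : ([set` S] #= `I_#|S|)%card.
Proof.
have -> : [set` S] = (@enum_val _ (mem S)) @` [set: 'I_#|S|].
  apply/seteqP; split => [x xS|_ [i _ <-]]; last exact: enum_valP.
  by exists (enum_rank_in xS x) => //; rewrite enum_rankK_in.
rewrite (card_eql (inj_card_eq _)); last by move=> i j _ _ /enum_val_inj.
exact/card_esym/card_II.
Qed.

Section Convexity.
Variables (R : realType) (d : nat).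
Implicit Types A : set 'rV[R]_d.

Lemma convex_set_segment A :
  (forall (x y : 'rV[R]_d) (t : R), 0 <= t -> t <= 1 -> A x -> A y ->
     A (t *: x + (1 - t) *: y)) -> convex_set A.
Proof.
move=> Aseg x y t /set_mem Ax /set_mem Ay; apply/mem_set.
by apply: (Aseg x y t%:num) => //; apply: le1.
Qed.

Lemma affB_conv (c : 'rV[R]_d * R) (v x y : 'rV[R]_d) (t : R) :
  aff c (t *: x + (1 - t) *: y - v) = t * aff c (x - v) + (1 - t) * aff c (y - v).
Proof.
rewrite !affE !mulrDr addrACA -[X in _ = _ + X]mulrDl subrKC mul1r; congr (_ + _).
by rewrite !mulr_sumr -big_split; apply: eq_bigr => j _; rewrite !mxE/=; ring.
Qed.

Lemma le_norm_conv (t a b e : R) : 0 <= t -> t <= 1 ->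
  `|a| <= e -> `|b| <= e -> `|t * a + (1 - t) * b| <= e.
Proof.
by rewrite !ler_norml => t0 t1 /andP[? ?] /andP[? ?]; apply/andP; split; nra.
Qed.

End Convexity.

(** * Lower bound for [HD] from an indexed family of bounded degree *)

Section FamilyBound.
Variables (R : realType) (d : nat) (s p q C : nat) (K : finType).
Variable M : K -> set 'rV[R]_d.
Hypothesis M_ne : forall x, M x !=set0.
Hypothesis M_conv : forall x, s_convex s (M x).
Hypothesis M_deg : forall y, (#|[set x | `[< M x y >]]%SET| <= C)%N.
Hypothesis M_pq : forall S : {set K}, (p <= #|S|)%N ->
  exists (H : {set K}) (y : 'rV[R]_d),
    [/\ H \subset S, #|H| = q & forall x, x \in H -> M x y].
Hypothesis p_gt0 : (0 < p)%N.
Hypothesis C_gt0 : (0 < C)%N.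
Hypothesis pC : (p * C <= #|K|)%N.

Let F := [set M x | x in [set: K]].

(** Assign to each index a point of [T] in its set. A point receives at most [C] indices, also when
    [M] takes the same value at several of them. *)
Lemma transversal_card (T : set 'rV[R]_d) n :
  Defs.transversal F T -> (T #<= `I_n)%card -> (#|K| <= n * C)%N.
Proof.
move=> FT /pcard_leP/unsquash h.
have /choice[pt ptP] : forall x, exists y, T y /\ M x y.
  by move=> x; have [|y [Ty My]] := FT (M x); [exists x | exists y].
have hn x : (h (pt x) < n)%N by have [Tx _] := ptP x; exact: (@funS _ _ _ _ h).
pose f x : 'I_n := Ordinal (hn x).
rewrite -sum1_card (partition_big f xpredT)//=.
apply: (@leq_trans (\sum_(i < n) C)); last by rewrite sum_nat_const card_ord.
apply: leq_sum => i _; rewrite sum1dep_card.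
have [->|[x0]] := set_0Vmem [set x | f x == i]%SET; first by rewrite cards0.
rewrite inE => /eqP fx0; apply: leq_trans (M_deg (pt x0)).
apply: subset_leq_card; apply/fintype.subsetP => x; rewrite !inE => /eqP fx.
suff -> : pt x0 = pt x by exact: (ptP x).2.
have [Tx0 _] := ptP x0; have [Tx _] := ptP x.
apply: (@inj _ _ T h); rewrite ?inE//.
by have := congr1 val (etrans fx0 (esym fx)).
Qed.

Lemma family_pq : pq_property p q F.
Proof.
have Ffin : finite_set F by apply: finite_image; exact: finite_finset.
split.
  (* One point from each member is a transversal, so [F] cannot have fewer than [#|K| / C] members,
     even if sets repeat. *)
  have /finite_setP[n Fn] := Ffin.
  have pn : (p <= n)%N.
    rewrite -(leq_pmul2r C_gt0) (leq_trans pC)//.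
    have /choice[pt ptP] : forall A : set 'rV[R]_d, exists y, F A -> A y.
      move=> A; have [[x _ <-]|] := pselect (F A); last by exists 0.
      by have [y My] := M_ne x; exists y.
    apply: (@transversal_card (pt @` F)).
      by move=> A FA; exists (pt A); split; [exists A | exact: ptP].
    apply: card_le_trans (card_image_le _ _) _.
    by move: Fn; rewrite card_eq_le => /andP[].
  rewrite (card_le_eqr Fn) card_le_II//.
move=> G GF Gp.
have x0 : K.
  have K0 : (0 < #|K|)%N by apply: leq_trans pC; rewrite muln_gt0 p_gt0.
  exact: (enum_val (Ordinal K0)).
(* One index is kept for each set, so that [S] has exactly as many elements as [G]. *)
have /choice[rep repP] : forall A, exists x, F A -> M x = A.
  by move=> A; have [[x _ <-]|nA] := pselect (F A); [exists x | exists x0].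
pose S : {set K} := [set x | `[< G (M x) >] && (rep (M x) == x)]%SET.
have Minj : {in [set` S] &, injective M}.
  move=> x y; rewrite !inE/= !inE => /andP[_ /eqP <-] /andP[_ /eqP <-].
  by rewrite !repP => [->|//|]; [|exists y|exists x].
have GE : M @` [set` S] = G.
  apply/seteqP; split => [_ [x xS <-]|A GA].
    by move: xS; rewrite /= inE => /andP[/asboolP].
  exists (rep A); last exact: repP (GF _ GA).
  by rewrite /= inE repP ?eqxx ?andbT; [exact/asboolP | exact: GF].
have Sp : #|S| = p.
  apply/(@card_eq_II _ _)/(card_eq_trans (card_esym (card_eq_finset S))).
  by rewrite -(card_eql (inj_card_eq Minj)) GE.
have [|H [y [HS Hq Hy]]] := M_pq (S := S); first by rewrite Sp.
exists (M @` [set` H]); split.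
- by rewrite -GE => _ [x xH <-]; exists x => //; exact: (fintype.subsetP HS).
- rewrite (card_eql (inj_card_eq _)); first by rewrite -Hq card_eq_finset.
  move=> x z /set_mem/= xH /set_mem/= zH.
  by apply: Minj; apply/mem_set; exact: (fintype.subsetP HS).
- by exists y => _ [x /Hy My <-].
Qed.

Lemma HD_ge_family : (((#|K|)%:R / C%:R)%:E <= HD R d s p q)%E.
Proof.
apply/least_geP => N HN.
have /HN : finite_set F by apply: finite_image; exact: finite_finset.
have FM A : F A -> A !=set0 /\ s_convex s A by move=> [x _ <-]; split.
move=> /(_ FM family_pq) /least_leP[n nN [T FT Tn]].
rewrite lee_fin ler_pdivrMr ?ltr0n// -natrM ler_nat.
have TIn : (T #<= `I_n)%card by move: Tn; rewrite card_eq_le => /andP[].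
by rewrite (leq_trans (transversal_card FT TIn))// leq_mul2r nN orbT.
Qed.

End FamilyBound.

(** * Disjoint copies of the space *)

Section Copies.
Variables (R : realType) (d s p q C1 C2 : nat) (i0 : 'I_d) (V : finType).
Local Notation K := ('I_s * V)%type.
Variables (c : V -> 'rV[R]_d * R) (g : K -> 'rV[R]_d * R) (delta : R).
Hypothesis slab_deg : forall y, (#|[set a | (`|aff (c a) y| <= delta)%R]%SET| <= C1)%N.
Hypothesis plane_deg : forall y, (#|[set x | (aff (g x) y == 0)%R]%SET| <= C2)%N.
Hypothesis slab_ne : forall a, exists y, `|aff (c a) y| <= delta.
Hypothesis crossing : forall S : {set K}, (p <= #|S|)%N ->
  exists (H : {set K}) (x0 : K) (y : 'rV[R]_d),
    [/\ H \subset S, #|H| = q, x0 \in H,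
        forall x, x \in H -> `|aff (c x.2) y| <= delta
      & forall x, x \in H -> x != x0 -> aff (g x) y = 0].

(** The copies are strips of half-width [B] across the axis [i0], with centres [3 * B] apart, hence
    disjoint. *)
Let shift (B : R) (n : nat) : 'rV[R]_d := (3 * B * n%:R) *: delta_mx 0 i0.

Let part (B : R) (n : nat) (x : K) : set 'rV[R]_d :=
  [set y | `|(y - shift B n) 0 i0| <= B /\
           if x.1 == n :> nat then `|aff (c x.2) (y - shift B n)| <= delta
           else aff (g x) (y - shift B n) == 0].

(** A point lies in at most one copy, where it meets at most [C1] slabs and [C2] perturbed
    hyperplanes, whatever [s] is. *)
Lemma HD_ge_copies : (0 < p)%N -> (0 < C1 + C2)%N ->
  (p * (C1 + C2) <= s * #|V|)%N ->
  (((s * #|V|)%:R / (C1 + C2)%:R)%:E <= HD R d s p q)%E.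
Proof.
move=> p0 C0 pC.
have /choice[ya yaP] := slab_ne.
pose Q (S : {set K}) (y : 'rV[R]_d) := (p <= #|S|)%N ->
  exists (H : {set K}) (x0 : K),
    [/\ H \subset S, #|H| = q, x0 \in H,
        forall x, x \in H -> `|aff (c x.2) y| <= delta
      & forall x, x \in H -> x != x0 -> aff (g x) y = 0].
have /choice[ys ysP] : forall S, exists y, Q S y.
  move=> S; have [pS|pS] := boolP (p <= #|S|)%N; last first.
    by exists 0; rewrite /Q (negbTE pS).
  by have [H [x0 [y HP]]] := crossing pS; exists y => _; exists H, x0.
(* Wide enough for each strip to contain its translates of all the points chosen in slabs and at
   crossings. *)
pose B : R := 1 + \sum_a `|ya a 0 i0| + \sum_(S : {set K}) `|ys S 0 i0|.
have sumV : 0 <= \sum_a `|ya a 0 i0| by exact: sumr_ge0.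
have sumK : 0 <= \sum_(S : {set K}) `|ys S 0 i0| by exact: sumr_ge0.
have B0 : 0 < B by rewrite /B; lra.
have yaB a : `|ya a 0 i0| <= B.
  have : `|ya a 0 i0| <= \sum_a `|ya a 0 i0|.
    by rewrite [leRHS](bigD1 a)//= lerDl sumr_ge0.
  rewrite /B; lra.
have ysB S : `|ys S 0 i0| <= B.
  have : `|ys S 0 i0| <= \sum_(S : {set K}) `|ys S 0 i0|.
    by rewrite [leRHS](bigD1 S)//= lerDl sumr_ge0.
  rewrite /B; lra.
pose M x := \bigcup_(n in `I_s) part B n x.
have region (y : 'rV[R]_d) n n' : `|(y - shift B n) 0 i0| <= B ->
    `|(y - shift B n') 0 i0| <= B -> n = n'.
  rewrite !mxE !eqxx/= !mulr1 => yn yn'.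
  apply/eqP; rewrite eqn_leq.
  wlog suff H : n n' yn yn' / (n <= n')%N.
    by rewrite (H n n' yn yn') (H n' n yn' yn).
  rewrite leqNgt; apply/negP; rewrite -(ler_nat R) -natr1.
  move: yn yn'; rewrite !ler_norml => /andP[y1 y2] /andP[y3 y4] nn'.
  have : 3 * B * (n'%:R + 1) <= 3 * B * n%:R by rewrite ler_pM2l// mulr_gt0.
  rewrite mulrDr mulr1; lra.
rewrite -[s in (s * _)%N]card_ord -card_prod.
apply: (@HD_ge_family R d s p q (C1 + C2) _ M) => //.
- move=> [i a]; exists (ya a + shift B i); exists (i : nat); first exact: ltn_ord.
  by rewrite /part/= addrK eqxx; split; [exact: yaB|exact: yaP].
- move=> x; exists [set part B n x | n in `I_s]; last by rewrite bigcup_image.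
  split; first exact: card_image_le.
  move=> _ [n _ <-]; apply: convex_set_segment => y z t t0 t1.
  rewrite /part/= => -[yB yx] [zB zx].
  have affi0 (v : 'rV[R]_d) : v 0 i0 = aff (delta_mx 0 i0, 0) v.
    rewrite affE addr0 (bigD1 i0)//= big1 => [|j ji].
      by rewrite mxE !eqxx mul1r addr0.
    by rewrite mxE (negbTE ji) andbF mul0r.
  move: yB zB; rewrite !affi0 affB_conv => yB zB; split; first exact: le_norm_conv.
  move: yx zx; case: ifP => _; rewrite affB_conv; first exact: le_norm_conv.
  by move=> /eqP-> /eqP->; rewrite !mulr0 addr0.
- move=> y.
  have [[n ns yn]|ny] :=
    pselect (exists2 n, (n < s)%N & `|(y - shift B n) 0 i0| <= B); last first.
    rewrite (_ : [set x | _]%SET = finset.set0) ?cards0//.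
    apply/setP => x; rewrite !inE; apply/asboolP => -[n ns [yn _]].
    by apply: ny; exists n.
  pose z := y - shift B n.
  apply: leq_trans (leq_add (slab_deg z) (plane_deg z)).
  have oinj : injective (pair (Ordinal ns) : V -> K) by move=> a b [].
  set A1 := [set a | _ <= _]%SET; rewrite -(card_imset (mem A1) oinj).
  apply: leq_trans (leq_card_setU _ _); apply: subset_leq_card.
  apply/fintype.subsetP => -[i a]; rewrite !inE => -[n' _ [yn' ]].
  rewrite (region y n' n)//=; case: eqP => [ni za|_ za].
    have -> : i = Ordinal ns by exact: val_inj.
    by rewrite (imset_f (pair (Ordinal ns))) ?inE//.
  by rewrite za orbT.
(* In the copy of [x0], a member of [H] with the same first index is a slab; any other differs from
   [x0], so its perturbed hyperplane passes through the crossing. *)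
- move=> S pS; have [H [x0 [HS Hq x0H Hc Hg]]] := ysP S pS.
  exists H, (ys S + shift B x0.1); split => // x xH.
  exists (x0.1 : nat); first exact: ltn_ord.
  rewrite /part/= addrK; split; first exact: ysB.
  case: eqP => xx0; first exact: Hc.
  by apply/eqP/Hg => //; apply: contra_not_neq xx0 => ->.
- by rewrite card_prod card_ord.
Qed.

End Copies.

(** * Choice of the parameters *)

Lemma HD_ge_grid (R : realType) (e m D s p0 : nat) :
    (0 < m)%N -> (0 < D)%N ->
    ((m + m) ^ D * m ^ 2 < p0 ^ 2)%N -> (m ^ e.+2 < p0)%N ->
    ((e.+3 * p0).+1 * (m ^ e.+3 + e.+3) <= s * m ^ D)%N ->
  (((s * m ^ D)%:R / (m ^ e.+3 + e.+3)%:R)%:E <= HD R e.+3 s (e.+3 * p0).+1 e.+4)%E.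
Proof.
move=> m0 D0 h1 h2 hp.
have [c [g [delta [dc dg cne cr]]]] := @crossing_planes R e m D s p0 m0 D0 h1 h2.
have cV : #|grid m D| = (m ^ D)%N by rewrite card_ffun !card_ord.
rewrite -cV; rewrite -cV in hp.
apply: (@HD_ge_copies _ _ _ _ _ _ _ ord0 _ c g delta dc dg cne cr) => //.
by rewrite addnS.
Qed.

(** With [m] fixed and [D] growing, [p] is [(2 * q) ^ D] up to a constant, so [p ^ 2] is about
    [(2 * m) ^ D], while the bound is about [s * m ^ D]. The lost factor [2 ^ D] is at most the
    power [gamma] of [p] by the choice of [q]. *)
Lemma HD_ge_power (R : realType) (d : nat) (gamma : R) : (3 <= d)%N -> 0 < gamma ->
  exists2 c : R, 0 < c &
    forall n0 : nat, exists p : nat,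
      [/\ (n0 <= p)%N, (d.+1 <= p)%N &
        forall s : nat, (1 <= s)%N ->
          ((c * s%:R * p%:R `^ (2 - gamma))%:E <= HD R d s p d.+1)%E].
Proof.
case: d => [|[|[|e]]]// _ gamma0; set d := e.+3.
pose q := (Num.trunc (2 `^ gamma^-1 : R)).+2.
have q2 : (2 <= q)%N by [].
have qgamma : 2 <= (2 * q)%:R `^ gamma :> R.
  have <- : (2 `^ gamma^-1) `^ gamma = 2 :> R.
    by rewrite -powRrM mulVf ?gt_eqF// powRr1.
  apply: ge0_ler_powR; rewrite ?nnegrE ?powR_ge0 ?ltW//.
  apply: lt_le_trans (truncnS_gt _) _.
  by rewrite ler_nat /q mul2n -addnn ltn_addr.
(* Twice a square, so that [(m + m) ^ D] is the square of [(2 * q) ^ D]. *)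
pose m := (2 * q ^ 2)%N; pose k := (2 * d * m ^ d)%N.
have m2 : (2 <= m)%N by rewrite /m leq_pmulr// expn_gt0.
have m0 : (0 < m)%N by rewrite ltnW.
have C0 : (0 < m ^ d + d)%N by rewrite addnS.
have k0 : (0 < k)%N by rewrite /k muln_gt0 expn_gt0 m0.
exists ((k%:R ^+ 2 * (m ^ d + d)%:R)^-1) => [|n0].
  by rewrite invr_gt0 mulr_gt0// ?exprn_gt0 ?ltr0n.
(* The summand [n0] makes [p] large; the other one lets [q ^ D] exceed [k * (m ^ d + d)], so that
   there are enough members. *)
pose D := (n0 + k * (m ^ d + d)).+1.
pose p0 := ((2 * q) ^ D * m ^ d)%N.
have q0D : (D < (2 * q) ^ D)%N by apply: ltn_expl; lia.
have p0D : ((2 * q) ^ D <= p0)%N by rewrite leq_pmulr// expn_gt0 m0.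
have p0_gt0 : (0 < p0)%N by apply: leq_trans p0D; rewrite expn_gt0 muln_gt0.
have pk : ((d * p0).+1 <= k * (2 * q) ^ D)%N.
  have -> : (k * (2 * q) ^ D = d * p0 + d * p0)%N by 
    by rewrite /k /p0 addnn -mul2n [in RHS](mulnC ((2 * q) ^ D)%N) !mulnA.
  by rewrite -addn1 leq_add2l muln_gt0.
have pp0 : (p0 <= (d * p0).+1)%N by rewrite leqW// leq_pmull.
have mD : (m ^ D = (2 * q) ^ D * q ^ D)%N.
  by rewrite -expnMn; congr expn; rewrite /m; ring.
exists (d * p0).+1; split => [||s s1].
- apply: leq_trans pp0; apply: leq_trans p0D; apply: leq_trans (ltnW q0D).
  by rewrite /D; lia.
- by rewrite ltnS leq_pmulr.
apply: le_trans (@HD_ge_grid R e m D s p0 _ _ _ _ _) => //.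
- have key : (d * p0).+1%:R `^ (2 - gamma) <= k%:R ^+ 2 * (m ^ D)%:R :> R.
    rewrite powRB ?pnatr_eq0 ?implybT// ler_pdivrMr ?powR_gt0 ?ltr0n//.
    rewrite powR_mulrn ?ler0n//.
    apply: (@le_trans _ _ ((k * (2 * q) ^ D)%:R ^+ 2)).
      by rewrite lerXn2r ?nnegrE ?ler0n// ler_nat.
    rewrite natrM exprMn -[leRHS]mulrA ler_pM2l ?exprn_gt0 ?ltr0n//.
    have lowpow : (2 ^ D)%:R <= (d * p0).+1%:R `^ gamma :> R.
      apply: (@le_trans _ _ ((((2 * q) ^ D)%:R : R) `^ gamma)); last first.
        by apply: ge0_ler_powR; rewrite ?nnegrE ?ler0n ?ltW// ltr_nat; lia.
      rewrite !natrX -[X in _ <= X `^ _]powR_mulrn ?ler0n//.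
      rewrite powRAC powR_mulrn ?powR_ge0//.
      by rewrite lerXn2r ?nnegrE ?powR_ge0// ler0n.
    apply: le_trans (ler_wpM2l (ler0n _ _) lowpow).
    have m2E : (m * 2 = (2 * q) ^ 2)%N by rewrite /m; ring.
    by rewrite -natrX -natrM ler_nat -expnMn m2E expnAC.
  have kC : 0 < (k%:R ^+ 2 * (m ^ d + d)%:R : R).
    by rewrite mulr_gt0 ?exprn_gt0 ?ltr0n.
  have fieldE (a b x y : R) : y != 0 -> a * b / y * (x * y) = a * (x * b).
    by move=> y0; field.
  rewrite lee_fin -[leLHS]mulrA [leLHS]mulrC ler_pdivrMr// natrM.
  rewrite fieldE ?pnatr_eq0 -?lt0n//.
  exact: ler_wpM2l key.
- have -> : (m + m = (2 * q) ^ 2)%N by rewrite /m; ring.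
  rewrite expnAC /p0 [ltnRHS]expnMn ltn_pmul2l ?expn_gt0 ?muln_gt0//.
  by rewrite -expnM ltn_exp2l// /d; lia.
- apply: (@leq_trans (m ^ d)); first by rewrite ltn_exp2l.
  by rewrite /p0 leq_pmull// expn_gt0 muln_gt0.
- apply: (@leq_trans (k * (2 * q) ^ D * (m ^ d + d))).
    by rewrite leq_mul2r pk orbT.
  apply: (@leq_trans (m ^ D)); last by rewrite leq_pmull.
  rewrite mD mulnAC mulnC leq_mul2l; apply/orP; right.
  apply: leq_trans (ltnW (ltn_expl D q2)).
  by rewrite /D; lia.
Qed.

Theorem theorem1p9 (R : realType) (d : nat) (hd : (3 <= d)%N) :
  (forall gamma : R, 0 < gamma ->
     exists2 c : R, 0 < c &
       forall n0 : nat, exists p : nat,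
         [/\ (n0 <= p)%N, (d.+1 <= p)%N &
           forall s : nat, (1 <= s)%N ->
             ((c * s%:R * p%:R `^ (2 - gamma))%:E <= HD R d s p d.+1)%E])
  /\
  (exists (p : nat -> nat) (eps : nat -> R),
     [/\ forall k, (p k < p k.+1)%N,
         forall k, (d.+1 <= p k)%N,
         eps @ \oo --> (0 : R) &
         forall k s : nat, (1 <= s)%N ->
           ((s%:R * (p k)%:R `^ (2 - eps k))%:E <= HD R d s (p k) d.+1)%E]).
Proof.
split=> [gamma gamma0|]; first exact: HD_ge_power.
(* Half of [eps k] is the [gamma] of the first part; the other half absorbs the constant [c] once
   [p] is large. *)
pose eps k : R := 2 * k.+1%:R^-1.
pose Q k p := (d.+1 <= p)%N /\ forall s : nat, (1 <= s)%N ->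
  ((s%:R * p%:R `^ (2 - eps k))%:E <= HD R d s p d.+1)%E.
have Qex (x : nat * nat) : exists p, (x.2 <= p)%N /\ Q x.1 p.
  case: x => k n /=; pose gamma : R := k.+1%:R^-1.
  have gamma0 : 0 < gamma by rewrite invr_gt0 ltr0n.
  have [c c0 /(_ (maxn n (Num.truncn (c^-1 `^ gamma^-1)).+1))] :=
    @HD_ge_power R d gamma hd gamma0.
  move=> [p [+ dp Hp]]; rewrite geq_max => /andP[np cp].
  exists p; split => //; split => // s s1; apply: le_trans (Hp s s1).
  have p0 : 0 < p%:R :> R by rewrite ltr0n; apply: leq_trans dp.
  rewrite lee_fin (mulrC c) -mulrA ler_wpM2l ?ler0n//.
  have -> : 2 - eps k = (2 - gamma) - gamma by rewrite /eps -/gamma; ring.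
  rewrite powRB ?(gt_eqF p0) ?implybT// mulrC ler_wpM2r ?powR_ge0//.
  rewrite -[leRHS]invrK lef_pV2 ?posrE ?invr_gt0 ?powR_gt0//.
  have <- : (c^-1 `^ gamma^-1) `^ gamma = c^-1.
    by rewrite -powRrM mulVf ?gt_eqF// powRr1// invr_ge0 ltW.
  apply: ge0_ler_powR; rewrite ?nnegrE ?powR_ge0 ?ltW//.
  by apply: lt_le_trans (truncnS_gt _) _; rewrite ler_nat.
have /choice[f fP] := Qex.
(* Asking for at least [(p k').+1] at each step makes the sequence strictly increasing. *)
pose p := fix p k := if k is k'.+1 then f (k, (p k').+1) else f (0, 0)%N.
have Qp k : Q k (p k).
  by case: k => [|k]; [exact: (fP (0, 0)%N).2 | exact: (fP (k.+1, _)).2].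
exists p, eps; split => [k|k||k s].
- exact: (fP (k.+1, (p k).+1)).1.
- exact: (Qp k).1.
- rewrite -(mulr0 2); apply: cvgM; first exact: cvg_cst.
  exact: cvg_harmonic.
- exact: (Qp k).2.
Qed.
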